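(* Let $\mathcal{S}$ be a linear convergent subdivision scheme with symbol $$a(z)=z^{-s}(1+z)\prod_{j=1}^m\frac{1+\alpha_j z}{1+\alpha_j},\qquad s\in\mathbb{Z},\ m\ge1,\ \alpha_j\in\mathbb{R}\setminus\{0,-1\},$$ such that $a(z)$ has at least one negative root in addition to the root $-1$ of the factor $1+z$ (i.e., $\alpha_i>0$ for at least one $i\in\{1,\dots,m\}$). Define $$\mu_1=\min_{\substack{i\in\{1,\dots,m\}\\ \alpha_i>0}}\max\Big\{\frac{1}{1+\alpha_i},\frac{\alpha_i}{1+\alpha_i}\Big\},$$ and renumber the factors $\frac{1+\alpha_jz}{1+\alpha_j}$ such that $\mu_1$ is attained at $\alpha_1$. If $$\mu=\mu_1\prod_{i=2}^m\xi(\alpha_i)<1,$$ where $$\xi(\alpha)=\begin{cases}1,&0<\alpha,\\ 1+2\left|\frac{\alpha}{1+\alpha}\right|,&-1<\alpha<0,\\ 1+2\left|\frac{1}{1+\alpha}\right|,&\alpha<-1,\end{cases}$$ then the adaptation $\widetilde{\mathcal{S}}$ of $\mathcal{S}$ to manifold data based on the global refinement step (described in the context) has contractivity factor $\mu$, and it converges from any admissible initial data on the manifold.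
   Context: Linear scheme and symbol: a linear subdivision scheme has a refinement rule $\mathcal{S}(\mathbf{f})_j=\sum_{i\in\mathbb{Z}}a_{j-2i}f_i$ with finitely supported real mask $(a_i)_{i\in\mathbb{Z}}$; its symbol is $a(z)=\sum_{i}a_iz^i$. The linear scheme is convergent if for any real data $\mathbf{f}$ the piecewise linear interpolants to the data $(i2^{-k},\mathcal{S}^k(\mathbf{f})_i)$ converge uniformly as $k\to\infty$. Geodesic averages: $\mathcal{M}$ is a complete connected Riemannian manifold with Riemannian distance $d$. For $p_1,p_2\in\mathcal{M}$, $t\mapsto M_t(p_1,p_2)$, $t\in[0,1]$, is the (canonically chosen, if not unique) shortest geodesic, parametrized with constant speed, with $M_0(p_1,p_2)=p_1$, $M_1(p_1,p_2)=p_2$. For the values $t\notin[0,1]$ that are used, $M_t(p_1,p_2)$ is assumed to be well-defined as a point on the continuation of this geodesic, and $d(M_t(p_1,p_2),p_2)=|1-t|\,d(p_1,p_2)$, $d(p_1,M_t(p_1,p_2))=|t|\,d(p_1,p_2)$ for all $t$ used. A data sequence $\mathbf{p}=(p_i)_{i\in\mathbb{Z}}$ in $\mathcal{M}$ is admissible if the geodesic curve between any two adjacent points is well-defined; all geodesic averages occurring in the repeated refinement are assumed well-defined. Put $\delta(\mathbf{p})=\sup_{i\in\mathbb{Z}}d(p_i,p_{i+1})$; data are understood to satisfy $\delta(\mathbf{p})<\infty$. Global refinement step $\mathbf{p}\mapsto\widetilde{\mathcal{S}}(\mathbf{p})$: set $q_{2i,0}=q_{2i+1,0}=p_i$ for $i\in\mathbb{Z}$;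 for $j=1,\dots,m$ successively set $q_{i,j}=M_{\frac{\alpha_j}{1+\alpha_j}}(q_{i,j-1},q_{i+1,j-1})$ for all $i\in\mathbb{Z}$; finally set $\widetilde{\mathcal{S}}(\mathbf{p})_{i-s+1}=q_{i,m}$ for all $i\in\mathbb{Z}$. The subdivision scheme is the repeated application of this step. Contractivity factor: $\widetilde{\mathcal{S}}$ has contractivity factor $\mu\in(0,1)$ if $\delta(\widetilde{\mathcal{S}}(\mathbf{p}))\le\mu\,\delta(\mathbf{p})$ for all data $\mathbf{p}$. Convergence: for $k\ge 0$ let $I(\widetilde{\mathcal{S}}^k(\mathbf{p})):\mathbb{R}\to\mathcal{M}$ be the piecewise geodesic interpolant that takes the value $\widetilde{\mathcal{S}}^k(\mathbf{p})_i$ at $i2^{-k}$ and, on $[i2^{-k},(i+1)2^{-k}]$, follows (with constant speed) the geodesic curve connecting $\widetilde{\mathcal{S}}^k(\mathbf{p})_i$ and $\widetilde{\mathcal{S}}^k(\mathbf{p})_{i+1}$. The scheme converges from $\mathbf{p}$ if the sequence $I(\widetilde{\mathcal{S}}^k(\mathbf{p}))$, $k\in\mathbb{Z}_+$, converges uniformly with respect to $d$. *)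

(* Defs.v *)
From HB Require Import structures.
From mathcomp Require Export all_boot all_order all_algebra.
From mathcomp Require Export all_classical all_reals all_analysis.
Set Implicit Arguments. Unset Strict Implicit. Unset Printing Implicit Defensive.
Import Order.TTheory GRing.Theory Num.Theory numFieldNormedType.Exports.
Local Open Scope classical_set_scope.
Local Open Scope ring_scope.

(* Iterated continuous partial derivatives on [U], which is meant to be open. *)
Fixpoint Ck (R : realType) (n : nat) (V : normedModType R) (k : nat)
    (U : set 'rV[R]_n) (f : 'rV[R]_n -> V) : Prop :=
  (forall x, U x -> {for x, continuous f}) /\
  match k with
  | 0 => True
  | k'.+1 => forall i : 'I_n,
      (forall x, U x -> derivable f x (delta_mx 0 i)) /\
      Ck k' U (fun x => 'D_(delta_mx 0 i) f x)
  end.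

Definition smooth_on (R : realType) (n : nat) (V : normedModType R)
    (U : set 'rV[R]_n) (f : 'rV[R]_n -> V) : Prop := forall k, Ck k U f.

(* [chart_fun] and [chart_inv] are junk outside [chart_dom] and its image. *)
Record chart (R : realType) (n : nat) (T : topologicalType) := Chart {
  chart_dom : set T;
  chart_fun : T -> 'rV[R]_n;
  chart_inv : 'rV[R]_n -> T }.

Definition is_chart (R : realType) (n : nat) (T : topologicalType)
    (phi : chart R n T) : Prop :=
  [/\ open (chart_dom phi),
      open (chart_fun phi @` chart_dom phi),
      forall x, chart_dom phi x -> chart_inv phi (chart_fun phi x) = x,
      forall x, chart_dom phi x -> {for x, continuous (chart_fun phi)} &
      forall y, (chart_fun phi @` chart_dom phi) y ->
        {for y, continuous (chart_inv phi)}].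

Definition transition (R : realType) (n : nat) (T : topologicalType)
    (phi psi : chart R n T) : 'rV[R]_n -> 'rV[R]_n :=
  chart_fun psi \o chart_inv phi.

Record smoothManifold (R : realType) (n : nat) := SmoothManifold {
  mspace :> topologicalType;
  mspace_hausdorff : hausdorff_space mspace;
  mspace_second_countable : @second_countable mspace;
  atlas : set (chart R n mspace);
  atlas_chart : forall phi, atlas phi -> is_chart phi;
  atlas_cover : forall x, exists phi, atlas phi /\ chart_dom phi x;
  atlas_smooth : forall phi psi, atlas phi -> atlas psi ->
    smooth_on (chart_fun phi @` (chart_dom phi `&` chart_dom psi))
              (transition phi psi) }.

(* A Riemannian metric is given by its component matrices (g_ij) in the charts
   of the atlas, as functions of the coordinates.  Tangent vectors are row
   vectors, so that a vector v transforms as [v *m jacobian]. *)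
Record riemannianMetric (R : realType) (n : nat) (M : smoothManifold R n) :=
  RiemannianMetric {
  metric : chart R n M -> 'rV[R]_n -> 'M[R]_n;
  metric_smooth : forall phi, atlas phi ->
    smooth_on (chart_fun phi @` chart_dom phi) (metric phi);
  metric_sym : forall phi x, atlas phi -> chart_dom phi x ->
    (metric phi (chart_fun phi x))^T = metric phi (chart_fun phi x);
  metric_posdef : forall phi x, atlas phi -> chart_dom phi x ->
    forall v : 'rV[R]_n, v != 0 ->
      0 < (v *m metric phi (chart_fun phi x) *m v^T) 0 0;
  metric_compat : forall phi psi x, atlas phi -> atlas psi ->
    chart_dom phi x -> chart_dom psi x ->
    let J := jacobian (transition phi psi) (chart_fun phi x) in
    metric phi (chart_fun phi x) =
      J *m metric psi (chart_fun psi x) *m J^T }.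

Definition chart_at (R : realType) (n : nat) (M : smoothManifold R n) (x : M) :
    chart R n M := sval (cid (atlas_cover x)).

Definition local_curve (R : realType) (n : nat) (M : smoothManifold R n)
    (c : R -> M) (phi : chart R n M) : R -> 'rV[R]_n := chart_fun phi \o c.

Definition C1_curve (R : realType) (n : nat) (M : smoothManifold R n)
    (c : R -> M) : Prop :=
  continuous c /\
  forall phi t, atlas phi -> chart_dom phi (c t) ->
    derivable (local_curve c phi) t 1 /\
    {for t, continuous (derive1 (local_curve c phi))}.

(* By [metric_compat] any other chart around [c t] gives the same value. *)
Definition speed (R : realType) (n : nat) (M : smoothManifold R n)
    (g : riemannianMetric M) (c : R -> M) (t : R) : R :=
  let phi := chart_at (c t) in
  let v := derive1 (local_curve c phi) t in
  Num.sqrt ((v *m metric g phi (chart_fun phi (c t)) *m v^T) 0 0).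

Definition curve_length (R : realType) (n : nat) (M : smoothManifold R n)
    (g : riemannianMetric M) (c : R -> M) : \bar R :=
  (\int[lebesgue_measure]_(t in `[0%R, 1%R]) (speed g c t)%:E)%E.

(* Piecewise C^1 curves from [p] to [q] are lists of C^1 pieces, each one
   reparametrized to [0, 1] and extended to a C^1 curve on the whole line, the
   end of each piece being the start of the next one. *)
Fixpoint piecewise_curve (R : realType) (n : nat) (M : smoothManifold R n)
    (p q : M) (cs : seq (R -> M)) : Prop :=
  match cs with
  | [::] => p = q
  | c :: cs' => [/\ C1_curve c, c 0 = p & piecewise_curve (c 1) q cs']
  end.

(* Finite for all pairs of points if the manifold is connected. *)
Definition rdist (R : realType) (n : nat) (M : smoothManifold R n)
    (g : riemannianMetric M) (p q : M) : \bar R :=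
  ereal_inf [set l | exists cs, piecewise_curve p q cs /\
                       l = (\sum_(c <- cs) curve_length g c)%E].

Definition complete_riemannian (R : realType) (n : nat) (M : smoothManifold R n)
    (g : riemannianMetric M) : Prop :=
  forall u : nat -> M,
    (forall eps : R, 0 < eps -> exists N : nat, forall i j : nat,
        (N <= i)%N -> (N <= j)%N -> (rdist g (u i) (u j) < eps%:E)%E) ->
    exists x : M, forall eps : R, 0 < eps ->
      \forall i \near \oo, (rdist g (u i) x < eps%:E)%E.

(* Christoffel symbols Gamma^k_ij of a field of symmetric matrices. *)
Definition christoffel (R : realType) (n : nat) (G : 'rV[R]_n -> 'M[R]_n)
    (x : 'rV[R]_n) (k i j : 'I_n) : R :=
  2^-1 * \sum_(l < n) invmx (G x) k l *
    ('D_(delta_mx 0 i) (fun y => G y j l) x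
     + 'D_(delta_mx 0 j) (fun y => G y i l) x
     - 'D_(delta_mx 0 l) (fun y => G y i j) x).

Definition geodesic (R : realType) (n : nat) (M : smoothManifold R n)
    (g : riemannianMetric M) (c : R -> M) : Prop :=
  continuous c /\
  forall phi t, atlas phi -> chart_dom phi (c t) ->
    let x := local_curve c phi in
    [/\ derivable x t 1,
        derivable (derive1 x) t 1 &
        forall k : 'I_n,
          (derive1n 2 x t) 0 k
          + \sum_(i < n) \sum_(j < n) christoffel (metric g phi) (x t) k i j
                                      * (derive1 x t) 0 i * (derive1 x t) 0 j = 0].

(* A solution of the geodesic equation has constant speed; the last clause
   spells this out for the part between [p] and [q]. *)
Definition shortest_geodesic (R : realType) (n : nat) (M : smoothManifold R n)
    (g : riemannianMetric M) (p q : M) (c : R -> M) : Prop :=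
  [/\ geodesic g c, c 0 = p, c 1 = q, curve_length g c = rdist g p q &
      forall t : R, 0 <= t <= 1 ->
        rdist g p (c t) = (t%:E * rdist g p q)%E /\
        rdist g (c t) q = ((1 - t)%:E * rdist g p q)%E].

(* The pairs in [D] are those for which the (canonically chosen) geodesic
   [t |-> geo t p q] from [p] to [q] is well-defined; outside [D] the values of
   [geo] are junk.  [geo t p q] is the average M_t(p, q). *)
Definition geodesic_choice (R : realType) (n : nat) (M : smoothManifold R n)
    (g : riemannianMetric M) (D : set (M * M)) (geo : R -> M -> M -> M) : Prop :=
  forall p q : M, D (p, q) -> shortest_geodesic g p q (fun t => geo t p q).

(* Beyond [0, 1] a geodesic need not be minimizing, so the two equalities are
   part of what it means for the average to be well-defined. *)
Definition avg_well_defined (R : realType) (n : nat) (M : smoothManifold R n)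
    (g : riemannianMetric M) (D : set (M * M)) (geo : R -> M -> M -> M)
    (t : R) (p q : M) : Prop :=
  [/\ D (p, q),
      rdist g (geo t p q) q = (`|1 - t|%:E * rdist g p q)%E &
      rdist g p (geo t p q) = (`|t|%:E * rdist g p q)%E].

Definition admissible (T : Type) (D : set (T * T)) (p : int -> T) : Prop :=
  forall i : int, D (p i, p (i + 1)).

Definition delta (R : realType) (T : Type) (d : T -> T -> \bar R)
    (p : int -> T) : \bar R :=
  ereal_sup (range (fun i : int => d (p i) (p (i + 1)))).

(* On [i 2^-k, (i+1) 2^-k] this is the curve [t |-> avg t (p i) (p (i+1))],
   rescaled from [0, 1]. *)
Definition interpolant (R : realType) (T : Type) (avg : R -> T -> T -> T)
    (k : nat) (p : int -> T) (x : R) : T :=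
  let y := x * 2 ^+ k in
  let i := Num.floor y in
  avg (y - i%:~R) (p i) (p (i + 1)).

Definition converges_uniformly (R : realType) (T : Type) (d : T -> T -> \bar R)
    (F : nat -> R -> T) : Prop :=
  exists f : R -> T, forall eps : R, 0 < eps ->
    \forall k \near \oo, forall x : R, (d (F k x) (f x) < eps%:E)%E.

Definition converges_from (R : realType) (T : Type) (d : T -> T -> \bar R)
    (avg : R -> T -> T -> T) (S : (int -> T) -> int -> T) (p : int -> T) : Prop :=
  converges_uniformly d (fun k => interpolant avg k (iter k S p)).

Definition linear_scheme (R : realType) (a : int -> R) (f : int -> R) (j : int) : R :=
  \sum_(i \in [set: int]) a (j - 2 * i) * f i.

Definition finite_mask (R : realType) (a : int -> R) : Prop :=
  finite_set [set i : int | a i != 0].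

(* The value of the Laurent polynomial at [z != 0]. *)
Definition symbol (R : realType) (a : int -> R) (z : R) : R :=
  \sum_(i \in [set: int]) a i * z ^ i.

Definition real_dist (R : realType) (x y : R) : \bar R := `|x - y|%:E.

Definition linear_avg (R : realType) (t x y : R) : R := (1 - t) * x + t * y.

(* Uniform convergence on the whole line only makes sense for data with
   bounded differences, cf. [delta]. *)
Definition linear_convergent (R : realType) (a : int -> R) : Prop :=
  forall f : int -> R, (delta (@real_dist R) f < +oo)%E ->
    converges_from (@real_dist R) (@linear_avg R) (linear_scheme a) f.

(* The factors are numbered from 1: only [alpha 1], ..., [alpha m] are used. *)
Fixpoint stage (R : realType) (T : Type) (avg : R -> T -> T -> T)
    (alpha : nat -> R) (p : int -> T) (j : nat) : int -> T :=
  match j with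
  | 0 => fun i => p (i %/ 2)%Z
  | j'.+1 => fun i =>
      avg (alpha j / (1 + alpha j))
        (stage avg alpha p j' i) (stage avg alpha p j' (i + 1))
  end.

Definition refine (R : realType) (T : Type) (avg : R -> T -> T -> T)
    (alpha : nat -> R) (m : nat) (s : int) (p : int -> T) : int -> T :=
  fun i => stage avg alpha p m (i + s - 1).

Definition step_well_defined (R : realType) (n : nat) (M : smoothManifold R n)
    (g : riemannianMetric M) (D : set (M * M)) (geo : R -> M -> M -> M)
    (alpha : nat -> R) (m : nat) (p : int -> M) : Prop :=
  forall j : nat, (j < m)%N -> forall i : int,
    avg_well_defined g D geo (alpha j.+1 / (1 + alpha j.+1))
      (stage geo alpha p j i) (stage geo alpha p j (i + 1)).

Definition contractivity_factor (R : realType) (n : nat) (M : smoothManifold R n)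
    (g : riemannianMetric M) (D : set (M * M)) (geo : R -> M -> M -> M)
    (alpha : nat -> R) (m : nat) (s : int) (mu : R) : Prop :=
  0 < mu < 1 /\
  forall p : int -> M,
    admissible D p -> (delta (rdist g) p < +oo)%E ->
    step_well_defined g D geo alpha m p ->
    (delta (rdist g) (refine geo alpha m s p) <= mu%:E * delta (rdist g) p)%E.

Definition scheme_converges (R : realType) (n : nat) (M : smoothManifold R n)
    (g : riemannianMetric M) (D : set (M * M)) (geo : R -> M -> M -> M)
    (alpha : nat -> R) (m : nat) (s : int) : Prop :=
  forall p : int -> M,
    admissible D p -> (delta (rdist g) p < +oo)%E ->
    (forall k, step_well_defined g D geo alpha m
                 (iter k (refine geo alpha m s) p)) ->
    converges_from (rdist g) geo (refine geo alpha m s) p.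

Definition max_weight (R : realType) (x : R) : R :=
  Num.max (1 / (1 + x)) (x / (1 + x)).

(* For [0 < x], [max_weight x < 1], so the default value 1 plays no role as soon
   as one of the [alpha i] is positive. *)
Definition mu1 (R : realType) (alpha : nat -> R) (m : nat) : R :=
  \big[Num.min/1]_(1 <= i < m.+1 | 0 < alpha i) max_weight (alpha i).

(* Only used for [x] different from 0 and -1. *)
Definition xi (R : realType) (x : R) : R :=
  if 0 < x then 1
  else if -1 < x then 1 + 2 * `|x / (1 + x)|
  else 1 + 2 * `|1 / (1 + x)|.

(* Main.v *)
(* One averaging stage with weight t multiplies delta by at most |1 - t| + |t|,
   which is xi; in the first stage every other difference of the data is zero,
   and the factor improves to max(|1 - t|, |t|).  This gives contractivity.
   A refined point stays within C delta(p) of the data point it comes from, so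
   consecutive piecewise geodesic interpolants are O(mu^k) apart and the limit
   exists by completeness.  The triangle inequality and the symmetry of the
   Riemannian distance come from concatenating and reversing curves. *)
From HB Require Import structures.
Require Import Defs.
From mathcomp Require Import all_boot all_order all_algebra.
From mathcomp Require Import all_classical all_reals all_analysis.
From mathcomp Require Import measurable_realfun ring lra zify.
Import Order.TTheory GRing.Theory Num.Theory numFieldNormedType.Exports.
Local Open Scope classical_set_scope.
Local Open Scope ring_scope.
Set Implicit Arguments. Unset Strict Implicit. Unset Printing Implicit Defensive.

(** * Reflection of the unit interval and Lebesgue integration *)

Lemma measurable_fun_onem (R : realType) : measurable_fun [set: measurableTypeR R]
  (fun t : measurableTypeR R => 1 - t : measurableTypeR R).
Proof. exact: measurable_funB. Qed.

(** The pushforward of Lebesgue measure under the reflection gives each half-open interval its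
    length, as []a, b]] is pulled back to [[1 - b, 1 - a[]. Uniqueness of Lebesgue measure carries
    this over to measurable sets. *)
Lemma lebesgue_measure_onem (R : realType) (A : set R) : measurable A ->
  lebesgue_measure ((fun t : R => 1 - t) @^-1` A) = lebesgue_measure A.
Proof.
move=> mA; pose f : {mfun measurableTypeR R >-> measurableTypeR R} :=
  mfun_Sub (mem_set (@measurable_fun_onem R)).
rewrite [RHS](@lebesgue_measure_unique R (pushforward lebesgue_measure f)) //.
move=> _ [[a b]] _ <-.
transitivity (lebesgue_measure `[1 - b, 1 - a[%classic); last first.
  congr lebesgue_measure; apply/seteqP.
  by split=> t; rewrite /preimage /= !in_itv /=; lra.
rewrite !lebesgue_measure_itv/= !lte_fin -!EFinB.
have -> : (1 - b < 1 - a) = (a < b) by apply/idP/idP; lra.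
by case: ifP => // _; congr (_%:E); ring.
Qed.

Import HBNNSimple.

Lemma nnsfun_onem (R : realType) (h : {nnsfun (measurableTypeR R) >-> R}) :
  exists h' : {nnsfun (measurableTypeR R) >-> R}, forall t, h' t = h (1 - t).
Proof.
pose f := fun t : measurableTypeR R => h (1 - t).
have mf : measurable_fun setT f.
  exact: measurableT_comp (measurable_funPT h) (@measurable_fun_onem R).
have ff : finite_set (range f).
  by apply: sub_finite_set (fimfunP h) => _ [t _ <-]; exists (1 - t).
have f_ge0 t : 0 <= f t by rewrite /f.
pose mfM := isMeasurableFun.Build _ _ _ _ f mf.
pose ffM := FiniteImage.Build _ _ f ff.
pose nfM := isNonNegFun.Build _ _ f f_ge0.
pose h' : {nnsfun (measurableTypeR R) >-> R} := HB.pack f mfM ffM nfM.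
by exists h'.
Qed.

Lemma sintegral_onem (R : realType) (h h' : {nnsfun (measurableTypeR R) >-> R}) :
  (forall t, h' t = h (1 - t)) ->
  sintegral lebesgue_measure h' = sintegral (@lebesgue_measure R) h.
Proof.
move=> hh'; rewrite !sintegralET; apply: eq_fsbigr => x _; congr (_ * _)%E.
rewrite -[RHS]lebesgue_measure_onem; last exact: (measurable_funPTI h (measurable_set1 x)).
by congr lebesgue_measure; apply/seteqP; split=> t /=; rewrite hh'.
Qed.

(* The integral of a nonnegative function is a supremum over the simple
   functions below it, which the reflection permutes; so [f], later the speed of
   a curve, may be nonmeasurable. *)
Lemma integral_onem (R : realType) (f : R -> \bar R) :
  (\int[lebesgue_measure]_(t in `[0%R, 1%R]) f (1 - t)%R =
   \int[lebesgue_measure]_(t in `[0%R, 1%R]) f t)%E.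
Proof.
have H (u v : R -> \bar R) : (forall t, u t = v (1 - t)) ->
  ereal_sup [set sintegral lebesgue_measure (h : R -> R) |
    h in [set h : {nnsfun (measurableTypeR R) >-> R} |
      forall t, ((h t)%:E <= u t)%E]] =
  ereal_sup [set sintegral lebesgue_measure (h : R -> R) |
    h in [set h : {nnsfun (measurableTypeR R) >-> R} |
      forall t, ((h t)%:E <= v t)%E]].
  move=> uv; congr ereal_sup; apply/seteqP.
  split=> _ [h /= hle <-]; have [h' h'E] := nnsfun_onem h; exists h';
    try exact: sintegral_onem.
  - by move=> t /=; rewrite h'E (le_trans (hle _)) // uv subKr.
  - by move=> t /=; rewrite h'E (le_trans (hle _)) // uv.
(* Restriction to [[0, 1]] commutes with the reflection, which maps this interval onto itself. *)
have E (u : R -> \bar R) t :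
  ((fun r => u (1 - r)) \_ `[0%R, 1%R]) t = (u \_ `[0%R, 1%R]) (1 - t).
  rewrite /patch !mem_setE.
  suff -> : (1 - t \in `[0, 1]) = (t \in `[0, 1]) by [].
  by rewrite !in_itv /=; apply/idP/idP; lra.
by rewrite /integral; congr (_ - _)%E; apply: H => t;
  rewrite ?funeposE ?funenegE E.
Qed.

(** * Reversal and concatenation of curves *)

Definition reverse_curve (R : realType) (T : Type) (c : R -> T) : R -> T :=
  fun t => c (1 - t).

Lemma onem_continuous (R : realType) : continuous (fun t : R => 1 - t).
Proof. by move=> t; apply: continuousB; [exact: cvg_cst | exact: cvg_id]. Qed.

Lemma derivable_reverse (R : realType) (V : normedModType R) (f : R -> V) (t : R) :
  derivable f (1 - t) 1 ->
  derivable (reverse_curve f) t 1 /\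
  derive1 (reverse_curve f) t = - derive1 f (1 - t).
Proof.
move=> df; have dif : differentiable f (1 - t) by apply/derivable1_diffP.
(* The difference quotient of the reversed curve is that of [f] at [1 - t] in direction [-1];
   linearity of the differential then produces the sign. *)
have E : (fun h : R => h^-1 *:
      ((reverse_curve f \o shift t) (h *: 1) - reverse_curve f t)) =
    (fun h : R => h^-1 *: ((f \o shift (1 - t)) (h *: (-1)) - f (1 - t))).
  apply/funext => h; rewrite /reverse_curve /shift /= scalerN; congr (_ *: (f _ - _)).
  by rewrite opprD; ring.
split; first by rewrite /derivable E; exact: diff_derivable.
by rewrite !derive1E /derive E -![lim _]/('D_ _ f _) !deriveE // linearN.
Qed.

Lemma C1_curve_reverse (R : realType) (n : nat) (M : smoothManifold R n)
  (c : R -> M) : C1_curve c -> C1_curve (reverse_curve c).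
Proof.
case=> cc dc; split.
  by move=> t; apply: continuous_comp; [exact: onem_continuous | exact: cc].
move=> phi t aphi phit; have [dl cdl] := dc phi (1 - t) aphi phit.
split; first exact: (derivable_reverse dl).1.
(* Continuity of the derivative at [t] needs the reversal formula on a whole neighbourhood. The
   curve stays in the open chart domain there. *)
have near_t : nbhs t (fun r : R => - derive1 (local_curve c phi) (1 - r) =
    derive1 (local_curve (reverse_curve c) phi) r).
  have [odom _ _ _ _] := atlas_chart aphi.
  have : nbhs t (fun r : R => chart_dom phi (c (1 - r))).
    have cr : {for t, continuous (fun r : R => c (1 - r))}.
      by apply: continuous_comp; [exact: onem_continuous | exact: cc].
    by apply: cr; exact: open_nbhs_nbhs.
  apply: filterS => r phir; symmetry.
  exact: (derivable_reverse (dc phi (1 - r) aphi phir).1).2.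
have : derive1 (local_curve (reverse_curve c) phi) r @[r --> t] -->
    derive1 (local_curve (reverse_curve c) phi) t; last by [].
rewrite -(nbhs_singleton near_t).
apply: (cvg_trans (near_eq_cvg near_t)).
apply: cvgN.
apply: (@continuous_comp _ _ _ (fun r : R => 1 - r)); last exact: cdl.
exact: onem_continuous.
Qed.

(** The chart in [speed] depends only on the point, so both sides use the same chart, and the sign
    of the velocity cancels in the quadratic form. *)
Lemma speed_reverse (R : realType) (n : nat) (M : smoothManifold R n)
  (g : riemannianMetric M) (c : R -> M) (t : R) : C1_curve c ->
  speed g (reverse_curve c) t = speed g c (1 - t).
Proof.
case=> _ dc; have [aphi phit] := svalP (cid (atlas_cover (c (1 - t)))).
have := dc _ _ aphi phit => -[/derivable_reverse [_ d] _].
rewrite /speed -[chart_at _]/(sval (cid (atlas_cover (c (1 - t))))).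
rewrite [derive1 _ _]d.
by rewrite linearN /= mulNmx mulNmx mulmxN opprK.
Qed.

Lemma curve_length_reverse (R : realType) (n : nat) (M : smoothManifold R n)
  (g : riemannianMetric M) (c : R -> M) : C1_curve c ->
  curve_length g (reverse_curve c) = curve_length g c.
Proof.
move=> C1c; rewrite /curve_length -[RHS]integral_onem.
by apply: eq_integral => t _; rewrite speed_reverse.
Qed.

Lemma piecewise_curve_cat (R : realType) (n : nat) (M : smoothManifold R n)
  (p q r : M) (cs ds : seq (R -> M)) :
  piecewise_curve p q cs -> piecewise_curve q r ds ->
  piecewise_curve p r (cs ++ ds).
Proof.
by elim: cs p => [p -> //|c cs IH p /= [C1c c0 pc] pd]; split=> //; exact: IH.
Qed.

Lemma piecewise_curve_reverse (R : realType) (n : nat) (M : smoothManifold R n)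
  (g : riemannianMetric M) (p q : M) (cs : seq (R -> M)) :
  piecewise_curve p q cs -> exists ds, piecewise_curve q p ds /\
    (\sum_(c <- ds) curve_length g c = \sum_(c <- cs) curve_length g c)%E.
Proof.
elim: cs p => [p /= ->|c cs IH p /= [C1c c0 /IH [ds [pd sd]]]]; first by exists [::].
exists (ds ++ [:: reverse_curve c]); split.
  apply: piecewise_curve_cat pd _; split; first exact: C1_curve_reverse.
    by rewrite /reverse_curve subr0.
  by rewrite /= /reverse_curve subrr.
by rewrite big_cat /= sd big_seq1 curve_length_reverse // big_cons addeC.
Qed.

(** * The Riemannian distance as an extended pseudometric *)

Lemma curve_length_ge0 (R : realType) (n : nat) (M : smoothManifold R n)
  (g : riemannianMetric M) (c : R -> M) : (0 <= curve_length g c)%E.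
Proof. by apply: integral_ge0 => t _; rewrite lee_fin sqrtr_ge0. Qed.

Lemma rdist_ge0 (R : realType) (n : nat) (M : smoothManifold R n)
  (g : riemannianMetric M) (p q : M) : (0 <= rdist g p q)%E.
Proof.
apply: le_ereal_inf_tmp => _ [cs [_ ->]].
by apply: sume_ge0 => c _; exact: curve_length_ge0.
Qed.

Lemma rdistxx (R : realType) (n : nat) (M : smoothManifold R n)
  (g : riemannianMetric M) (p : M) : rdist g p p = 0%E.
Proof.
apply/eqP; rewrite eq_le rdist_ge0 andbT; apply: ereal_inf_lbound.
by exists [::]; rewrite big_nil.
Qed.

Lemma rdistC (R : realType) (n : nat) (M : smoothManifold R n)
  (g : riemannianMetric M) (p q : M) : rdist g p q = rdist g q p.
Proof.
congr ereal_inf; apply/seteqP.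
by split=> _ [cs [/(piecewise_curve_reverse g) [ds [pd sd]] ->]];
  exists ds; rewrite sd.
Qed.

Lemma rdist_triangle (R : realType) (n : nat) (M : smoothManifold R n)
  (g : riemannianMetric M) (p q r : M) :
  (rdist g p r <= rdist g p q + rdist g q r)%E.
Proof.
(* Infinite values make the right-hand side infinite. Finite ones can be moved across the
   inequality, which frees one infimum at a time: first over chains [cs] from [p] to [q], then over
   chains [ds] from [q] to [r]. *)
have [->|qr] := eqVneq (rdist g q r) +oo%E.
  by rewrite addey ?leey // gt_eqF // (lt_le_trans _ (rdist_ge0 g p q)) ?ltNyr.
rewrite -leeBlDr; last by rewrite ge0_fin_numE ?rdist_ge0 // ltey.
apply: le_ereal_inf_tmp => _ [cs [pcs ->]].
rewrite leeBlDr ?ge0_fin_numE ?rdist_ge0 ?ltey //.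
have s0 (us : seq (R -> M)) : (0 <= \sum_(c <- us) curve_length g c)%E.
  by apply: sume_ge0 => c _; exact: curve_length_ge0.
have [->|scs] := eqVneq (\sum_(c <- cs) curve_length g c)%E +oo%E.
  by rewrite addye ?leey // gt_eqF // (lt_le_trans _ (rdist_ge0 g q r)) ?ltNyr.
rewrite -leeBlDl ?ge0_fin_numE ?ltey //.
apply: le_ereal_inf_tmp => _ [ds [pds ->]].
rewrite leeBlDl ?ge0_fin_numE ?ltey // -big_cat.
by apply: ereal_inf_lbound; exists (cs ++ ds); split=> //; exact: piecewise_curve_cat pds.
Qed.

Lemma rdist_le_trans (R : realType) (n : nat) (M : smoothManifold R n)
  (g : riemannianMetric M) (p q r : M) (a b : \bar R) :
  (rdist g p q <= a -> rdist g q r <= b -> rdist g p r <= a + b)%E.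
Proof. by move=> pq qr; apply: le_trans (rdist_triangle g p q r) _; exact: leeD. Qed.

(** * Uniform convergence from geometrically decaying steps *)

Lemma rdist_geometric_converges (R : realType) (n : nat) (M : smoothManifold R n)
  (g : riemannianMetric M) (F : nat -> R -> M) (A mu : R) :
  complete_riemannian g -> 0 < mu < 1 -> 0 <= A ->
  (forall k x, rdist g (F k x) (F k.+1 x) <= (A * mu ^+ k)%:E)%E ->
  converges_uniformly (rdist g) F.
Proof.
(* [B] is the sum of the geometric series with first term [A]. The step bound [A * mu ^+ k] equals
   [B * (mu ^+ k - mu ^+ k.+1)] and telescopes. *)
move=> cpl /andP[mu0 mu1] A0 dF; pose B := A / (1 - mu).
have B0 : 0 <= B by rewrite divr_ge0 // subr_ge0 ltW.
have AB : A = B * (1 - mu) by rewrite divfK // subr_eq0 gt_eqF.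
have tele k l x : (rdist g (F k x) (F (k + l)%N x) <= (B * (mu ^+ k - mu ^+ (k + l)))%:E)%E.
  elim: l => [|l IH]; first by rewrite addn0 rdistxx subrr mulr0.
  rewrite addnS; apply: le_trans (rdist_le_trans IH (dF _ _)) _.
  by rewrite -EFinD lee_fin exprS AB; lra.
have tail k l x : (k <= l)%N -> (rdist g (F k x) (F l x) <= (B * mu ^+ k)%:E)%E.
  move=> /subnKC <-; apply: le_trans (tele _ _ _) _; rewrite lee_fin.
  by rewrite ler_wpM2l // gerBl exprn_ge0 // ltW.
have small eps : 0 < eps -> exists N, forall k, (N <= k)%N -> B * mu ^+ k < eps.
  move=> eps0; have /cvgrPdist_lt /(_ _ eps0) [N _ HN] :
      (fun k => B * mu ^+ k) @ \oo --> (0 : R).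
    rewrite -[X in _ --> X](mulr0 B); apply: cvgMr; apply: cvg_expr.
    by rewrite ger0_norm // ltW.
  exists N => k /HN /=; rewrite sub0r normrN; apply: le_lt_trans.
  exact: ler_norm.
have lim_ex x : exists y : M, forall eps : R, 0 < eps ->
    \forall i \near \oo, (rdist g (F i x) y < eps%:E)%E.
  apply: cpl => eps /small [N HN]; exists N => i j Ni Nj.
  have [ij|/ltnW ji] := leqP i j.
    by apply: le_lt_trans (tail _ _ _ ij) _; rewrite lte_fin HN.
  by rewrite rdistC; apply: le_lt_trans (tail _ _ _ ji) _; rewrite lte_fin HN.
have [f Hf] := choice lim_ex.
exists f => eps eps0; have e2 : 0 < eps / 2 by rewrite divr_gt0.
have [N HN] := small _ e2; exists N => // k /= Nk x.
(* [N'] depends on [x], but only the intermediate index [maxn k N'] involves it. The bound [tail]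
   does not, so [N] serves all [x]. *)
have [N' _ HN'] := Hf x _ e2.
apply: le_lt_trans (rdist_triangle g _ (F (maxn k N') x) _) _.
rewrite [eps]splitr EFinD; apply: lteD; last by apply: HN'; rewrite /= leq_maxr.
by apply: le_lt_trans (tail _ _ _ (leq_maxl _ _)) _; rewrite lte_fin HN.
Qed.

(** * Effect of the averaging stages on [delta] *)

Lemma rdist_le_delta (R : realType) (n : nat) (M : smoothManifold R n)
  (g : riemannianMetric M) (p : int -> M) (i : int) :
  (rdist g (p i) (p (i + 1)%R) <= delta (rdist g) p)%E.
Proof. by apply: ereal_sup_ubound; exists i. Qed.

Lemma delta_ge0 (R : realType) (n : nat) (M : smoothManifold R n)
  (g : riemannianMetric M) (p : int -> M) : (0 <= delta (rdist g) p)%E.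
Proof. exact: le_trans (rdist_ge0 _ _ _) (rdist_le_delta g p 0). Qed.

Lemma delta_le (R : realType) (T : Type) (d : T -> T -> \bar R)
  (p : int -> T) (b : \bar R) :
  (forall i, d (p i) (p (i + 1)%R) <= b)%E -> (delta d p <= b)%E.
Proof. by move=> H; apply: ge_ereal_sup => _ [i _ <-]. Qed.

Lemma rdist_le_path (R : realType) (n : nat) (M : smoothManifold R n)
  (g : riemannianMetric M) (p : int -> M) (i j : int) (N : nat) :
  (`|i - j| <= N)%N -> (rdist g (p i) (p j) <= N%:R%:E * delta (rdist g) p)%E.
Proof.
have fwd k (l : int) :
    (rdist g (p l) (p (l + k%:Z)%R) <= k%:R%:E * delta (rdist g) p)%E.
  elim: k => [|k IH]; first by rewrite addr0 rdistxx mul0e.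
  have -> : l + k.+1%:Z = l + k%:Z + 1 by lia.
  rewrite -natr1 EFinD ge0_muleDl ?lee_fin ?ler0n // mul1e.
  exact: rdist_le_trans IH (rdist_le_delta _ _ _).
move=> ijN; apply: (@le_trans _ _ (`|i - j|%N%:R%:E * delta (rdist g) p)%E).
  have [ij|ji] := leP i j.
    by have {1}-> : j = i + `|i - j|%N by lia.
  by rewrite rdistC; have {1}-> : i = j + `|i - j|%N by lia.
by rewrite lee_wpmul2r ?delta_ge0 // lee_fin ler_nat.
Qed.

(** The two averages lie on geodesics that share the point [q]; the triangle inequality is applied
    through [q]. *)
Lemma avg_pair_le (R : realType) (n : nat) (M : smoothManifold R n)
  (g : riemannianMetric M) (D : set (M * M)) (geo : R -> M -> M -> M)
  (t : R) (p q r : M) :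
  avg_well_defined g D geo t p q -> avg_well_defined g D geo t q r ->
  (rdist g (geo t p q) (geo t q r) <=
     `|1 - t|%:E * rdist g p q + `|t|%:E * rdist g q r)%E.
Proof. by case=> _ pq _ [_ _ qr]; rewrite -pq -qr; exact: rdist_triangle. Qed.

Lemma delta_stage0 (R : realType) (n : nat) (M : smoothManifold R n)
  (g : riemannianMetric M) (geo : R -> M -> M -> M) (alpha : nat -> R)
  (p : int -> M) : (delta (rdist g) (stage geo alpha p 0) <= delta (rdist g) p)%E.
Proof.
apply: delta_le => i /=; have H : (`|(i %/ 2)%Z - ((i + 1)%R %/ 2)%Z| <= 1)%N by lia.
by apply: le_trans (rdist_le_path g p H) _; rewrite mul1e.
Qed.

Lemma delta_stageS (R : realType) (n : nat) (M : smoothManifold R n)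
  (g : riemannianMetric M) (D : set (M * M)) (geo : R -> M -> M -> M)
  (alpha : nat -> R) (m j : nat) (p : int -> M) :
  step_well_defined g D geo alpha m p -> (j < m)%N ->
  (delta (rdist g) (stage geo alpha p j.+1) <=
     (`|1 - alpha j.+1 / (1 + alpha j.+1)| + `|alpha j.+1 / (1 + alpha j.+1)|)%:E
       * delta (rdist g) (stage geo alpha p j))%E.
Proof.
move=> wd jm; apply: delta_le => i /=.
apply: le_trans (avg_pair_le (wd j jm i) (wd j jm (i + 1))) _.
rewrite EFinD ge0_muleDl ?lee_fin //.
by apply: leeD; apply: lee_wpmul2l; rewrite ?lee_fin //; exact: rdist_le_delta.
Qed.

(* Of the two distances bounded in [avg_pair_le] one vanishes, since the points
   are doubled in [stage 0]. *)
Lemma delta_stage1 (R : realType) (n : nat) (M : smoothManifold R n)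
  (g : riemannianMetric M) (D : set (M * M)) (geo : R -> M -> M -> M)
  (alpha : nat -> R) (m : nat) (p : int -> M) :
  step_well_defined g D geo alpha m p -> (0 < m)%N -> 0 < alpha 1%N ->
  (delta (rdist g) (stage geo alpha p 1) <=
     (max_weight (alpha 1%N))%:E * delta (rdist g) p)%E.
Proof.
move=> wd m0 a0; apply: delta_le => i.
apply: le_trans (avg_pair_le (wd 0%N m0 i) (wd 0%N m0 (i + 1))) _.
set t := _ / _.
have t1 : `|1 - t| = 1 / (1 + alpha 1%N).
  have -> : 1 - t = 1 / (1 + alpha 1%N) by rewrite /t; field; lra.
  by rewrite ger0_norm // divr_ge0 //; lra.
have t_ge0 : 0 <= t by rewrite /t divr_ge0 //; lra.
have wle u : u <= max_weight (alpha 1%N) -> forall q r : M,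
    0 <= u -> (rdist g q r <= delta (rdist g) p)%E ->
    (u%:E * rdist g q r <= (max_weight (alpha 1%N))%:E * delta (rdist g) p)%E.
  by move=> ule q r u0 qr; apply: lee_pmul => //; rewrite ?lee_fin ?rdist_ge0.
have st k : (rdist g (stage geo alpha p 0 k) (stage geo alpha p 0 (k + 1)%R) <=
    delta (rdist g) p)%E.
  exact: le_trans (rdist_le_delta _ _ _) (delta_stage0 _ _ _ _).
(* For even [i] the first pair coincides and the weight [t] survives; for odd [i] the second pair
   coincides and [1 - t] survives. [max_weight] bounds both. *)
have [E|E] : (i %/ 2)%Z = ((i + 1)%R %/ 2)%Z \/
    ((i + 1)%R %/ 2)%Z = ((i + 1 + 1)%R %/ 2)%Z by lia.
  rewrite [X in (_ * X + _)%E]/= E rdistxx mule0 add0e.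
  by apply: wle; rewrite // ger0_norm // /max_weight le_max lexx orbT.
rewrite [X in (_ + _ * X)%E]/= E rdistxx mule0 adde0.
by apply: wle => //; rewrite t1 /max_weight le_max lexx.
Qed.

(** The weights [t = x / (1 + x)] and [1 - t = 1 / (1 + x)] add up to 1. Their absolute values
    therefore add up to 1 if both are nonnegative, and otherwise to 1 plus twice the absolute value
    of the negative one: [t] for [-1 < x < 0], [1 - t] for [x < -1]. *)
Lemma xiE (R : realType) (x : R) : x != 0 -> x != -1 ->
  xi x = `|1 - x / (1 + x)| + `|x / (1 + x)|.
Proof.
move=> x0 x1; have nz : 1 + x != 0 by rewrite addrC addr_eq0.
have E : 1 - x / (1 + x) = 1 / (1 + x) by field.
rewrite /xi; case: ltP => [xp|xn].
  have p1 : 0 <= 1 / (1 + x) by rewrite divr_ge0 //; lra.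
  have p2 : 0 <= x / (1 + x) by rewrite divr_ge0 //; lra.
  by rewrite E !ger0_norm // -E; ring.
case: ltP => [xm|xm].
  have p1 : 0 <= 1 / (1 + x) by rewrite divr_ge0 //; lra.
  have p2 : x / (1 + x) <= 0 by rewrite ler_pdivrMr ?mul0r //; lra.
  by rewrite E (ger0_norm p1) (ler0_norm p2) -E; ring.
have p1 : 1 / (1 + x) <= 0 by rewrite mul1r invr_le0; lra.
have p2 : 0 <= x / (1 + x) by lra.
by rewrite E (ler0_norm p1) (ger0_norm p2) -E; ring.
Qed.

(** Counting from [j.+1] starts the induction at the first stage, where the doubled data give the
    factor [max_weight]; each later stage contributes a factor [xi]. *)
Lemma delta_stage_le (R : realType) (n : nat) (M : smoothManifold R n)
  (g : riemannianMetric M) (D : set (M * M)) (geo : R -> M -> M -> M)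
  (alpha : nat -> R) (m : nat) (p : int -> M) :
  (forall j, (1 <= j <= m)%N -> alpha j != 0 /\ alpha j != -1) ->
  0 < alpha 1%N -> step_well_defined g D geo alpha m p ->
  forall j, (j < m)%N ->
  (delta (rdist g) (stage geo alpha p j.+1) <=
     (max_weight (alpha 1%N) * \prod_(2 <= i < j.+2) xi (alpha i))%:E
       * delta (rdist g) p)%E.
Proof.
move=> aneq a0 wd; elim=> [|j IH] jm.
  by rewrite big_geq // mulr1; exact: delta_stage1 wd jm a0.
apply: le_trans (delta_stageS wd jm) _.
have [aj0 aj1] := aneq j.+2 jm.
rewrite big_nat_recr //= mulrA [X in (X%:E * delta _ p)%E]mulrC EFinM -muleA -xiE //.
apply: lee_wpmul2l; last exact: IH (ltnW jm).
by rewrite lee_fin xiE // addr_ge0.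
Qed.

Lemma max_weight_gt0 (R : realType) (x : R) : 0 < x -> 0 < max_weight x.
Proof. by move=> x0; rewrite lt_max divr_gt0 //; lra. Qed.

Lemma xi_gt0 (R : realType) (x : R) : 0 < xi x.
Proof.
by rewrite /xi; do 2?case: ifP => _ //; rewrite ltr_wpDr // mulr_ge0.
Qed.

Lemma delta_refine (R : realType) (n : nat) (M : smoothManifold R n)
  (g : riemannianMetric M) (geo : R -> M -> M -> M) (alpha : nat -> R) (m : nat)
  (s : int) (p : int -> M) :
  (delta (rdist g) (refine geo alpha m s p) <=
     delta (rdist g) (stage geo alpha p m))%E.
Proof.
apply: delta_le => i; rewrite /refine.
have -> : i + 1 + s - 1 = i + s - 1 + 1 by lia.
exact: rdist_le_delta.
Qed.

(** * Distance between consecutive interpolants *)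

Lemma step_well_defined_admissible (R : realType) (n : nat) (M : smoothManifold R n)
  (g : riemannianMetric M) (D : set (M * M)) (geo : R -> M -> M -> M)
  (alpha : nat -> R) (m : nat) (p : int -> M) :
  (0 < m)%N -> step_well_defined g D geo alpha m p -> admissible D p.
Proof.
(* At the odd index [2 * i + 1] of the doubled data, the first stage averages [p i] and
   [p (i + 1)]. *)
move=> m0 wd i; have [] := wd 0%N m0 (2 * i + 1) => /=.
have -> : ((2 * i + 1)%R %/ 2)%Z = i by lia.
by have -> : ((2 * i + 1 + 1)%R %/ 2)%Z = i + 1 by lia.
Qed.

(** Stage [k.+1] moves each point by [|t k|] times a distance between neighbours in stage [k], which
    is at most a multiple [K] of [delta p]; [C] sums these displacements. It is chosen before [p],
    so that one constant serves all refinement levels. *)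
Lemma rdist_stage_doubled (R : realType) (n : nat) (M : smoothManifold R n)
  (g : riemannianMetric M) (D : set (M * M)) (geo : R -> M -> M -> M)
  (alpha : nat -> R) (m j : nat) : (j <= m)%N ->
  exists C : R, [/\ 0 <= C & forall p, step_well_defined g D geo alpha m p ->
    forall i, (rdist g (p (i %/ 2)%Z) (stage geo alpha p j i) <=
      C%:E * delta (rdist g) p)%E].
Proof.
pose t k := alpha k.+1 / (1 + alpha k.+1).
have stageK k : (k <= m)%N -> exists K : R, [/\ 0 <= K &
    forall p, step_well_defined g D geo alpha m p ->
    (delta (rdist g) (stage geo alpha p k) <= K%:E * delta (rdist g) p)%E].
  elim: k => [_|k IH km].
    by exists 1; split=> // p _; rewrite mul1e; exact: delta_stage0.
  have [K [K0 HK]] := IH (ltnW km).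
  exists ((`|1 - t k| + `|t k|) * K); split=> [|p wd].
    by rewrite mulr_ge0 // addr_ge0.
  apply: le_trans (delta_stageS wd km) _; rewrite EFinM -muleA.
  by apply: lee_wpmul2l (HK p wd); rewrite lee_fin addr_ge0.
elim: j => [_|j IH jm].
  by exists 0; split=> // p _ i; rewrite rdistxx mul0e.
have [C [C0 HC]] := IH (ltnW jm); have [K [K0 HK]] := stageK j (ltnW jm).
exists (C + `|t j| * K); split=> [|p wd i]; first by rewrite addr_ge0 // mulr_ge0.
rewrite EFinD ge0_muleDl ?lee_fin ?mulr_ge0 //.
apply: rdist_le_trans (HC p wd i) _; have [_ _] := wd j jm i => /= ->.
rewrite EFinM -muleA; apply: lee_wpmul2l; rewrite ?lee_fin //.
exact: le_trans (rdist_le_delta _ _ _) (HK p wd).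
Qed.

Lemma rdist_interpolant_le (R : realType) (n : nat) (M : smoothManifold R n)
  (g : riemannianMetric M) (D : set (M * M)) (geo : R -> M -> M -> M)
  (k : nat) (p : int -> M) (x : R) :
  geodesic_choice g D geo -> admissible D p ->
  (rdist g (p (Num.floor (x * 2 ^+ k))) (interpolant geo k p x) <=
    delta (rdist g) p)%E.
Proof.
move=> gc adm; rewrite /interpolant; set y := x * _; set i := Num.floor y.
have [_ _ _ _ H] := gc _ _ (adm i).
have t01 : 0 <= y - i%:~R <= 1.
  have /andP[] := floor_itv y; rewrite -/i intrD; lra.
have [-> _] := H _ t01; rewrite -[leRHS]mul1e.
by apply: lee_pmul; rewrite ?lee_fin ?rdist_ge0 ?rdist_le_delta //; lra.
Qed.

Lemma rdist_interpolant_refine (R : realType) (n : nat) (M : smoothManifold R n)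
  (g : riemannianMetric M) (D : set (M * M)) (geo : R -> M -> M -> M)
  (alpha : nat -> R) (m : nat) (s : int) : geodesic_choice g D geo ->
  exists C : R, [/\ 0 <= C & forall p k x,
    step_well_defined g D geo alpha m p ->
    admissible D p -> admissible D (refine geo alpha m s p) ->
    (delta (rdist g) (refine geo alpha m s p) <= delta (rdist g) p)%E ->
    (rdist g (interpolant geo k p x)
             (interpolant geo k.+1 (refine geo alpha m s p) x) <=
       C%:E * delta (rdist g) p)%E].
Proof.
move=> gc; have [C [C0 HC]] := rdist_stage_doubled g D geo alpha (leqnn m).
(* One summand for each leg of the path: back along the coarse geodesic to its left node [p i],
   along the data to the parent of the fine left node, from the parent to that node, and out along
   the fine geodesic. *)
exists (1 + (`|s| + 1)%N%:R + C + 1); split=> [|p k x wd adm adm' dle].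
  by rewrite !addr_ge0.
have d0 := delta_ge0 g p.
rewrite !EFinD !ge0_muleDl ?lee_fin ?addr_ge0 // mul1e.
set i := Num.floor (x * 2 ^+ k); set i' := Num.floor (x * 2 ^+ k.+1).
(* Halving the mesh makes [i'] equal to [2 * i] or [2 * i + 1]. The fine node [i'] is the stage
   point of index [i' + s - 1], so its parent has half that index. *)
have ii' : (`|i - ((i' + s - 1)%R %/ 2)%Z| <= `|s| + 1)%N.
  have /andP[l1 l2] := floor_itv (x * 2 ^+ k).
  have /andP[u1 u2] := floor_itv (x * 2 ^+ k.+1).
  have E : x * 2 ^+ k.+1 = 2 * (x * 2 ^+ k) by rewrite exprS; ring.
  rewrite -/i -/i' E in l1 l2 u1 u2.
  have a1 : i' < 2 * i + 2.
    rewrite -(ltr_int R) intrD intrM; rewrite intrD in l2; lra.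
  have a2 : 2 * i < i' + 1.
    rewrite -(ltr_int R) intrM; lra.
  lia.
apply: rdist_le_trans; first apply: rdist_le_trans; first apply: rdist_le_trans.
- by rewrite rdistC; exact: (@rdist_interpolant_le R n M g D geo k p x).
- exact: rdist_le_path ii'.
- exact: HC.
- exact: le_trans (@rdist_interpolant_le R n M g D geo k.+1 _ x gc adm') dle.
Qed.

Unset Implicit Arguments.

(** * Contractivity and convergence of the scheme *)

Theorem theorem3p4 (R : realType)
  (n : nat) (M : smoothManifold R n) (g : riemannianMetric M)
  (M_connected : connected [set: M]) (M_complete : complete_riemannian g)
  (D : set (M * M)) (geo : R -> M -> M -> M)
  (geo_choice : geodesic_choice g D geo)
  (a : int -> R) (a_finite : finite_mask a) (a_convergent : linear_convergent a)
  (s : int) (m : nat) (m_ge1 : (1 <= m)%N) (alpha : nat -> R)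
  (alpha_neq : forall j, (1 <= j <= m)%N -> alpha j != 0 /\ alpha j != -1)
  (a_symbol : forall z : R, z != 0 ->
     symbol a z = z ^ (- s) * (1 + z) *
       \prod_(1 <= j < m.+1) ((1 + alpha j * z) / (1 + alpha j)))
  (alpha_pos : exists i, (1 <= i <= m)%N /\ 0 < alpha i)
  (mu1_attained : 0 < alpha 1%N /\ mu1 alpha m = max_weight (alpha 1%N))
  (mu : R) (mu_def : mu = mu1 alpha m * \prod_(2 <= i < m.+1) xi (alpha i))
  (mu_lt1 : mu < 1) :
  contractivity_factor g D geo alpha m s mu /\
  scheme_converges g D geo alpha m s.
Proof.
have [a0 mu1E] := mu1_attained; rewrite mu1E in mu_def.
have mu_gt0 : 0 < mu.
  by rewrite mu_def mulr_gt0 ?max_weight_gt0 // prodr_gt0 // => i _; exact: xi_gt0.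
have contr p : step_well_defined g D geo alpha m p ->
    (delta (rdist g) (refine geo alpha m s p) <= mu%:E * delta (rdist g) p)%E.
  move=> wd; apply: le_trans (delta_refine _ _ _ _ _ _) _.
  (* The index [m.-1] refers to the last stage [m], where the product is complete and the factor
     equals [mu]. *)
  have := @delta_stage_le R n M g D geo alpha m p alpha_neq a0 wd m.-1.
  by rewrite prednK // leqnn -mu_def; exact.
split; first by split=> [|p _ _ /contr //]; rewrite mu_gt0.
move=> p _ dfin wd; pose P k := iter k (refine geo alpha m s) p.
have adm k : admissible D (P k).
  exact: step_well_defined_admissible m_ge1 (wd k).
(* [delta] of the initial data is finite, so that the decay of the levels is a real geometric
   sequence [d0 * mu ^+ k]. *)
pose d0 := fine (delta (rdist g) p).
have d0E : delta (rdist g) p = d0%:E by rewrite fineK // ge0_fin_numE ?delta_ge0.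
have dP k : (delta (rdist g) (P k) <= (d0 * mu ^+ k)%:E)%E.
  elim: k => [|k IH]; first by rewrite mulr1 d0E.
  apply: le_trans (contr _ (wd k)) _; rewrite exprS mulrCA EFinM.
  by apply: lee_wpmul2l; rewrite // lee_fin ltW.
have [C [C0 HC]] := @rdist_interpolant_refine R n M g D geo alpha m s geo_choice.
apply: (@rdist_geometric_converges R n M g _ (C * d0) mu) => //.
- by rewrite mu_gt0.
- by rewrite mulr_ge0 // fine_ge0 // delta_ge0.
move=> k x; rewrite -mulrA EFinM.
(* The side condition that [delta] does not grow from level [k] to [k.+1] follows from contractivity
   and [mu < 1]. *)
apply: le_trans (HC (P k) k x (wd k) (adm k) (adm k.+1) _) _.
  apply: le_trans (contr _ (wd k)) _; rewrite -[leRHS]mul1e.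
  by apply: lee_wpmul2r; rewrite ?delta_ge0 // lee_fin ltW.
by apply: lee_wpmul2l; rewrite ?lee_fin.
Qed.
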